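(* Let $\mathbb{X}\subset\mathbb{R}^n$, $\mathbb{U}\subset\mathbb{R}^p$, $\mathbb{Y}\subset\mathbb{R}^m$ be Borel sets. Let $\mathcal{T}(\cdot|x,u)$ be a stochastic kernel from $\mathbb{X}\times\mathbb{U}$ to $\mathbb{X}$, and let $Q$ be an observation channel which does not depend on the control variable, i.e. a stochastic kernel $Q(\cdot|x)$ from $\mathbb{X}$ to $\mathbb{Y}$. Assume that $\mathcal{T}$ is continuous in total variation in $(x,u)$: whenever $(x_n,u_n)\to(x,u)$ in $\mathbb{X}\times\mathbb{U}$, one has $\|\mathcal{T}(\cdot|x_n,u_n)-\mathcal{T}(\cdot|x,u)\|_{TV}\to 0$. Then the transition probability $\eta(\cdot|z,u)$ of the filter process is weakly continuous in $(z,u)$: whenever $z_n\to z$ weakly in $\mathbb{Z}=\mathcal{P}(\mathbb{X})$ and $u_n\to u$ in $\mathbb{U}$, one has $\eta(\cdot|z_n,u_n)\to\eta(\cdot|z,u)$ weakly in $\mathcal{P}(\mathbb{Z})$.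
   Context: For a separable metric space $S$, $\mathcal{P}(S)$ is the set of Borel probability measures on $S$, with the topology of weak convergence: $\mu_n\to\mu$ weakly iff $\int f\,d\mu_n\to\int f\,d\mu$ for all bounded continuous $f:S\to\mathbb{R}$. The total variation norm is $\|\mu-\nu\|_{TV}=2\sup_{B\in\mathcal{B}(S)}|\mu(B)-\nu(B)|$. A stochastic kernel from $S_1$ to $S_2$ is a map $(s,B)\mapsto K(B|s)$ such that $K(\cdot|s)$ is a Borel probability measure on $S_2$ for each $s\in S_1$ and $K(B|\cdot)$ is Borel measurable for each $B\in\mathcal{B}(S_2)$. Let $\mathbb{Z}=\mathcal{P}(\mathbb{X})$, equipped with the topology of weak convergence and its Borel $\sigma$-algebra. For $(z,u)\in\mathbb{Z}\times\mathbb{U}$ define the probability measure on $\mathbb{X}\times\mathbb{Y}$ $$R(B\times C|u,z)=\int_{\mathbb{X}}\int_B Q(C|x_1)\,\mathcal{T}(dx_1|x_0,u)\,z(dx_0),\quad B\in\mathcal{B}(\mathbb{X}),\ C\in\mathcal{B}(\mathbb{Y}),$$ and its $\mathbb{Y}$-marginal $P(C|z,u)=R(\mathbb{X}\times C|u,z)$. Disintegrate $R$ as $$R(B\times C|u,z)=\int_C F(B|y,u,z)\,P(dy|z,u),$$ where $F$ is a stochastic kernel from $\mathbb{Z}\times\mathbb{Y}\times\mathbb{U}$ to $\mathbb{X}$, and write $F(z,u,y):=F(\cdot|y,u,z)\in\mathbb{Z}$. The transition probability of the filter process is the stochastic kernel $\eta$ from $\mathbb{Z}\times\mathbb{U}$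 to $\mathbb{Z}$ given by $$\eta(D|z,u)=\int_{\mathbb{Y}}1_{\{F(z,u,y)\in D\}}\,P(dy|z,u),\quad D\in\mathcal{B}(\mathbb{Z}).$$ *)

(* Defs.v *)
From HB Require Import structures.
From mathcomp Require Import all_boot all_order all_algebra.
From mathcomp Require Import all_classical all_reals all_analysis.
From mathcomp Require Import measurable_realfun.

Set Implicit Arguments.
Unset Strict Implicit.
Unset Printing Implicit Defensive.
Import Order.TTheory GRing.Theory Num.Theory.
Import numFieldNormedType.Exports.

Local Open Scope classical_set_scope.
Local Open Scope ring_scope.

HB.instance Definition _ (S1 S2 : ptopologicalType) :=
  Pointed.on (S1 * S2)%type.

Definition borel (S : ptopologicalType) : measurableType (@open S).-sigma :=
  g_sigma_algebraType (@open S).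

(* [set_type A] with its subspace topology.  Measurable types are pointed in
   MathComp-Analysis: the proof [A0] only serves to provide a default element
   and does not affect the topology. *)
Definition subsp (S : topologicalType) (A : set S) (A0 : A !=set0) : Type := A.

Section subsp.
Context (S : topologicalType) (A : set S) (A0 : A !=set0).

Let subsp_pt : subsp A0 := SigSub (mem_set (projT2 (cid A0))).

HB.instance Definition _ := Topological.copy (subsp A0) (set_type A).
HB.instance Definition _ := isPointed.Build (subsp A0) subsp_pt.

End subsp.

Definition bounded_continuous (R : realType) (S : topologicalType)
  (f : S -> R) : Prop := continuous f /\ exists M, forall x, `|f x| <= M.

Definition Pr (R : realType) (S : ptopologicalType) : Type :=
  probability (borel S) R.

HB.instance Definition _ (R : realType) (S : ptopologicalType) :=
  Pointed.copy (Pr R S) (probability (borel S) R).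

(* The coarsest topology for which [mu |-> \int f dmu] is continuous for every
   bounded continuous [f]. *)
HB.instance Definition _ (R : realType) (S : ptopologicalType) :=
  Topological.copy (Pr R S)
    (sup_topology (fun f : {f : S -> R | bounded_continuous f} =>
       Topological.on (initial_topology
         (fun mu : Pr R S => (\int[mu]_(x in [set: borel S]) sval f x : R))))).

Lemma Pr_cvgP (R : realType) (S : ptopologicalType) (mu_ : nat -> Pr R S)
    (mu : Pr R S) :
  mu_ @ \oo --> mu <->
  forall f : S -> R, bounded_continuous f ->
    (\int[mu_ n]_(x in [set: borel S]) f x : R) @[n --> \oo] -->
    (\int[mu]_(x in [set: borel S]) f x : R).
Proof.
pose I (f : S -> R) (nu : Pr R S) : R := \int[nu]_(x in [set: borel S]) f x.
split=> [/cvg_sup + f bf|h].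
  move=> /(_ (exist _ f bf)) cf B.
  move=> /(@initial_continuous (Pr R S) R (I f) mu) /= /cf; exact.
apply/cvg_sup => -[f bf] B /=.
rewrite (@nbhsE (initial_topology (I f))) => -[C [[D oD <-] Dmu] CB].
apply: filterS CB _; apply: (h f bf).
by apply: open_nbhs_nbhs; split.
Qed.

Definition tv_norm d (T : measurableType d) (R : realType)
    (mu nu : probability T R) : R :=
  2 * sup [set `|fine (mu B) - fine (nu B)| | B in measurable].

(* When [S1] is a product of spaces, measurability is relative to the Borel
   sigma-algebra of the product topology. *)
Definition stoch (R : realType) (S1 S2 : ptopologicalType) : Type :=
  R.-pker (borel S1) ~> (borel S2).

Section at_point.
Context d d' (T : measurableType d) (T' : measurableType d') (R : realType).
Variable k : R.-pker T ~> T'.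

Definition kat (x : T) : set T' -> \bar R := k x.

HB.instance Definition _ x := Measure.on (kat x).
HB.instance Definition _ x :=
  Measure_isProbability.Build _ _ _ (kat x) (prob_kernel x).

End at_point.

Definition kpr (R : realType) (S1 S2 : ptopologicalType)
  (K : stoch R S1 S2) (s : S1) : Pr R S2 := kat K s.

Definition tv_continuous (R : realType) (S1 S2 : ptopologicalType)
    (K : stoch R S1 S2) : Prop :=
  forall (s_ : nat -> S1) (s : S1), s_ @ \oo --> s ->
    tv_norm (kpr K (s_ n)) (kpr K s) @[n --> \oo] --> (0 : R).

Section filter_process.
Context (R : realType) (X U Y : ptopologicalType).
Variables (T : stoch R (X * U)%type X) (Q : stoch R X Y).
Local Open Scope ereal_scope.

(* The measure [R(. | u, z)] on [X * Y], given by its value on every measurable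
   set; its characterization on rectangles is [jointX] below. *)
Definition joint (z : Pr R X) (u : U) (A : set (borel X * borel Y)) : \bar R :=
  \int[z]_x0 \int[kpr T (x0, u)]_x1 Q x1 (xsection A x1).

Lemma measurable_pair_snd (u : U) :
  measurable_fun [set: borel X] (fun x => (x, u) : borel (X * U)%type).
Proof.
apply: (@measurability _ _ (borel X) (borel (X * U)%type) setT _
  (@open (X * U)%type)) => //.
move=> _ [B oB <-]; rewrite setTI; apply: sub_sigma_algebra.
have /continuousP : continuous (fun x : X => (x, u)); last exact.
by move=> x; apply: cvg_pair => /=; [exact: cvg_id|exact: cvg_cst].
Qed.

Let inner (x1 : borel X) A := Q x1 (xsection A x1).

Let measurable_inner (A : set (borel X * borel Y)) : measurable A ->
  measurable_fun [set: borel X] (fun x1 => inner x1 A).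
Proof.
by move=> mA; apply: measurable_fun_xsection_finite_kernel; rewrite inE.
Qed.

Let measurable_outer (u : U) (A : set (borel X * borel Y)) : measurable A ->
  measurable_fun [set: borel X]
  (fun x0 : borel X => \int[kpr T (x0, u)]_x1 inner x1 A).
Proof.
move=> mA.
apply: (@measurable_fun_integral_kernel _ _ _ _ _
  (fun x0 : borel X => T (x0, u))) => //; last exact: measurable_inner.
move=> B mB; apply: (measurableT_comp (measurable_kernel T _ mB)).
exact: measurable_pair_snd.
Qed.

Section measure.
Variables (z : Pr R X) (u : U).

Let joint0 : joint z u set0 = 0.
Proof.
apply: integral0_eq => x0 _; apply: integral0_eq => x1 _.
by rewrite xsection0 measure0.
Qed.

Let joint_ge0 A : 0 <= joint z u A.
Proof. by apply: integral_ge0 => x0 _; exact: integral_ge0. Qed.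

Let joint_sigma_additive : semi_sigma_additive (joint z u).
Proof.
move=> F mF tF mUF.
have innerE x1 : inner x1 (\bigcup_n F n) = \sum_(n <oo) inner x1 (F n).
  rewrite /inner xsection_bigcup; apply/esym/cvg_lim => //.
  apply: measure_semi_sigma_additive.
  - by move=> i; exact: measurable_xsection.
  - exact: trivIset_xsection.
  - by apply: bigcup_measurable => i _; exact: measurable_xsection.
rewrite (_ : joint z u (\bigcup_n F n) = \sum_(n <oo) joint z u (F n)).
  exact: is_cvg_nneseries.
rewrite /joint -integral_nneseries//; last first.
- by move=> n x _; exact: integral_ge0.
- by move=> n; exact: measurable_outer.
apply: eq_integral => x0 _.
rewrite -integral_nneseries//; last by move=> n; exact: measurable_inner.
by apply: eq_integral => x1 _; exact: innerE.
Qed.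

HB.instance Definition _ := isMeasure.Build _ _ _ (joint z u)
  joint0 joint_ge0 joint_sigma_additive.

Let jointT : joint z u setT = 1.
Proof.
have -> : joint z u setT = \int[z]_x0 cst 1 x0.
  apply: eq_integral => x0 _ /=.
  rewrite (eq_integral (cst 1)).
    by rewrite integral_cst// mul1e; exact: prob_kernel.
  by move=> x1 _; rewrite xsectionE preimage_setT prob_kernel.
by rewrite integral_cst// mul1e; exact: probability_setT.
Qed.

HB.instance Definition _ :=
  Measure_isProbability.Build _ _ _ (joint z u) jointT.

Lemma jointX (B : set (borel X)) (C : set (borel Y)) :
  measurable B -> measurable C ->
  joint z u (B `*` C) = \int[z]_x0 \int[kpr T (x0, u)]_(x1 in B) Q x1 C.
Proof.
move=> mB mC; apply: eq_integral => x0 _.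
rewrite [RHS]integral_mkcond; apply: eq_integral => x1 _.
rewrite patchE; case: ifPn => x1B; first by rewrite in_xsectionX.
by rewrite notin_xsectionX// measure0.
Qed.

(* [P(C | z, u)], the [Y]-marginal of [R(. | u, z)]. *)
Definition marginal (C : set (borel Y)) : \bar R := joint z u ([set: X] `*` C).

Let marginalE : marginal = pushforward (joint z u) snd.
Proof. by apply/funext => C; rewrite /marginal /pushforward setTX. Qed.

Let marginal0 : marginal set0 = 0.
Proof. by rewrite marginalE measure0. Qed.

Let marginal_ge0 C : 0 <= marginal C.
Proof. exact: measure_ge0. Qed.

Let marginal_sigma_additive : semi_sigma_additive marginal.
Proof. by rewrite marginalE; exact: measure_semi_sigma_additive. Qed.

HB.instance Definition _ := isMeasure.Build _ _ _ marginal
  marginal0 marginal_ge0 marginal_sigma_additive.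

Let marginalT : marginal setT = 1.
Proof. by rewrite /marginal setXTT probability_setT. Qed.

HB.instance Definition _ :=
  Measure_isProbability.Build _ _ _ marginal marginalT.

End measure.

(* [F (z, y, u) B] is [F(B | y, u, z)]. *)
Definition disintegrates (F : stoch R (Pr R X * Y * U)%type X) : Prop :=
  forall (z : Pr R X) (u : U) (B : set (borel X)) (C : set (borel Y)),
    measurable B -> measurable C ->
    joint z u (B `*` C) =
    \int[marginal z u]_(y in C) F (z, y, u) B.

Definition filter_transition (F : stoch R (Pr R X * Y * U)%type X)
    (eta : stoch R (Pr R X * U)%type (Pr R X)) : Prop :=
  forall (z : Pr R X) (u : U) (D : set (borel (Pr R X))), measurable D ->
    eta (z, u) D = \int[marginal z u]_y (\1_D (kpr F (z, y, u)))%:E.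

End filter_process.

(* Main.v *)
Require Import Defs.
From mathcomp Require Import all_boot all_order all_algebra.
From mathcomp Require Import all_classical all_reals all_analysis.
From mathcomp Require Import measurable_realfun.
From mathcomp Require Import ring lra.
Import numFieldNormedType.Exports.
Import Order.TTheory GRing.Theory Num.Theory.

Set Implicit Arguments.
Unset Strict Implicit.
Unset Printing Implicit Defensive.

Local Open Scope classical_set_scope.
Local Open Scope ring_scope.

(** Write [p(z, u)] for the law of the next state, the mixture of the laws
    [T(. | x, u)] under [z(dx)].  The joint law of the next state and the next
    observation is obtained from [p(z, u)] by the fixed channel [Q].

    The first point is that the joint law depends on [(z, u)] continuously in
    total variation, although [z] only moves weakly ([joint_tv_continuous]).
    A measurable set [A] of states and observations has joint probability
    [\int f_A(x, u) z(dx)], where [f_A(x, u)] is its probability given the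
    previous state [x].  Continuity of [T] in total variation makes the functions
    [f_A(., u)] equicontinuous uniformly in [A], and makes [f_A(., u_n)] approach
    [f_A(., u)] locally uniformly, again uniformly in [A].  Weak convergence of
    [z_n] is uniform over such families: a partition of unity localizes the
    integrals to regions where the functions are nearly constant, up to a
    remainder of small mass ([uniform_weak_cvg]).

    The second point turns this into convergence of the filter.  If two joint
    laws are [e]-close on every measurable set, then for every set [B] of states
    the posterior probabilities of [B] are [4e]-close in [L^1] of the observation
    law ([L1_dist_densities]).  So along a subsequence they converge, for almost
    every observation [y], simultaneously for all [B] in a given countable family
    ([ae_cvg_subseq]).  Taking for [B] the finite unions of basic open sets of the
    state space, this is weak convergence of the posteriors ([cvg_base_union]).
    Every continuous bounded function of the posterior then converges almost
    everywhere along the subsequence, hence so do its integrals by dominated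
    convergence; since the observation laws converge in total variation, the
    integrals against the moving observation laws have the same limit.  As every
    subsequence can be treated in this way, the whole sequence converges
    ([filter_transition_cvg]).

    For these integrals to be integrals against the filter transition, the
    posterior must be a Borel function of the observation.  This holds because
    every weakly open set of measures is a countable union of sets defined by
    finitely many rational constraints on the masses of finite unions of basic
    open sets ([nbhs_rational_box], [measurable_fun_Pr]). *)

(** * Integrals of bounded functions *)

Section bounded_integrals.
Context d (T : measurableType d) (R : realType).
Implicit Types (mu nu : probability T R) (f g h : T -> R).

Lemma bounded_integrable mu f M : measurable_fun setT f ->
  (forall x, `|f x| <= M) -> mu.-integrable setT (EFin \o f).
Proof.
move=> mf fM; apply: measurable_bounded_integrable => //.
  by rewrite -ge0_fin_numE// fin_num_measure.
exists M; split; rewrite ?num_real// => K MK x _.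
exact: le_trans (fM x) (ltW MK).
Qed.

Lemma integrable_EFinD mu f g :
  mu.-integrable setT (EFin \o f) -> mu.-integrable setT (EFin \o g) ->
  mu.-integrable setT (EFin \o (fun x => f x + g x)).
Proof. by move=> fi gi; exact: (integrableD _ fi gi). Qed.

Lemma integrable_EFinB mu f g :
  mu.-integrable setT (EFin \o f) -> mu.-integrable setT (EFin \o g) ->
  mu.-integrable setT (EFin \o (fun x => f x - g x)).
Proof. by move=> fi gi; exact: (integrableB _ fi gi). Qed.

Lemma integrable_EFinZl mu f r : mu.-integrable setT (EFin \o f) ->
  mu.-integrable setT (EFin \o (fun x => r * f x)).
Proof. by move=> fi; exact: (integrableZl _ r fi). Qed.

Lemma unit_integrable mu f : measurable_fun setT f ->
  (forall x, 0 <= f x <= 1) -> mu.-integrable setT (EFin \o f).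
Proof.
move=> mf f01; apply: (@bounded_integrable _ _ 1) => // x.
by have /andP[f0 f1] := f01 x; rewrite ger0_norm.
Qed.

Lemma Rintegral_indic1 mu (A : set T) : measurable A ->
  \int[mu]_x (\1_A x : R) = fine (mu A).
Proof. by move=> mA; rewrite /Rintegral integral_indic// setIT. Qed.

Lemma Rintegral_cst1 mu (r : R) : \int[mu]_x r = r.
Proof. by rewrite Rintegral_cst//= probability_setT mulr1. Qed.

Lemma Rintegral_indic_sum mu (A : nat -> set T) n :
  (forall i, measurable (A i)) ->
  mu.-integrable setT (EFin \o (fun x => \sum_(i < n) (\1_(A i) x : R))) /\
  \int[mu]_x (\sum_(i < n) (\1_(A i) x : R)) = \sum_(i < n) fine (mu (A i)).
Proof.
move=> mA; elim: n => [|n [IHi IH]].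
  rewrite big_ord0 (_ : (fun x => _) = cst 0); last first.
    by apply/funext => x; rewrite big_ord0.
  rewrite Rintegral_cst1; split=> //; apply: (@bounded_integrable _ _ 0) => //.
  by move=> x; rewrite /= normr0.
rewrite big_ord_recr/= (_ : (fun x => _) =
    (fun x => \sum_(i < n) (\1_(A i) x : R) + \1_(A n) x)); last first.
  by apply/funext => x; rewrite big_ord_recr.
rewrite RintegralD ?IH ?Rintegral_indic1//; last exact: integrable_indic.
split=> //; by apply: integrable_EFinD => //; exact: integrable_indic.
Qed.

(** The pointwise form of the layer-cake approximation. *)
Lemma count_below (m : R) n : 0 <= m -> m <= n%:R ->
  \sum_(i < n) ((i.+1%:R < m)%R%:R : R) <= m
    <= \sum_(i < n) ((i.+1%:R < m)%R%:R : R) + 1.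
Proof.
move=> m0 mn; pose s k := \sum_(i < k) ((i.+1%:R < m)%R%:R : R).
(* Either the count has caught up with [m], or all the indices so far count. *)
have H k : [/\ s k <= m, s k <= k%:R & m <= s k + 1 \/ s k = k%:R].
  rewrite /s; elim: k => [|k [sm sk H]]; rewrite ?big_ord0//.
    by split=> //; right.
  rewrite big_ord_recr/=; set t := \sum_(i < k) _ in sm sk H *.
  rewrite -natr1; case: ltrP => /= km.
  - split; [lra|lra|].
    by case: H => [H|->]; [left; lra|right].
  - rewrite addr0; split=> //; first lra.
    by left; case: H => [//|->].
have [sm _ [->|sn]] := H n; first by rewrite sm.
by rewrite -/(s n) sm sn (le_trans mn)// lerDl.
Qed.

(** A Riemann sum of the layer-cake formula
    [\int h = \int_0^1 mu (h > t) dt]. *)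
Definition layer_sum mu h N : R :=
  N.+1%:R^-1 * \sum_(i < N.+1) fine (mu [set x | i.+1%:R / N.+1%:R < h x]).

Lemma measurable_superlevel h r : measurable_fun setT h ->
  measurable [set x | r < h x].
Proof.
move=> mh; rewrite (_ : mkset _ = setT `&` h @^-1` `]r, +oo[%classic).
  exact: mh.
by rewrite setTI; apply/seteqP; split=> x /=; rewrite in_itv/= andbT.
Qed.

(** Replaces an integral by finitely many masses of superlevel sets, with an
    error independent of the measure: this is how statements on sets are turned
    into statements on integrals below. *)
Lemma layer_sum_approx mu h N : measurable_fun setT h ->
  (forall x, 0 <= h x <= 1) ->
  layer_sum mu h N <= \int[mu]_x h x <= layer_sum mu h N + N.+1%:R^-1.
Proof.
move=> mh h01.
have N0 : (0 : R) < N.+1%:R by rewrite ltr0n.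
pose A i := [set x | i.+1%:R / N.+1%:R < h x].
have mA i : measurable (A i) by exact: measurable_superlevel.
have [iA intA] := Rintegral_indic_sum mu N.+1 mA.
have ih := unit_integrable mu mh h01.
have key x : \sum_(i < N.+1) (\1_(A i) x : R) <= N.+1%:R * h x
    <= \sum_(i < N.+1) (\1_(A i) x : R) + 1.
  have /andP[h0 h1] := h01 x.
  under eq_bigr => i _.
    rewrite indicE (_ : (x \in A i) = (i.+1%:R < N.+1%:R * h x)); last first.
      by apply/idP/idP; rewrite inE /A/= ltr_pdivrMr// mulrC.
    over.
  by apply: count_below; [rewrite mulr_ge0// ltW|rewrite ler_piMr// ltW].
have iNh : mu.-integrable setT (EFin \o (fun x => N.+1%:R * h x)).
  exact: integrable_EFinZl.
rewrite /layer_sum -[X in _ <= _ <= _ + X]mulr1 -mulrDr.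
rewrite -[_ <= \int[mu]_x h x]/(_ <= _) !(mulrC N.+1%:R^-1).
rewrite ler_pdivrMr// ler_pdivlMr// mulrC -RintegralZl// -intA.
apply/andP; split.
  by apply: le_Rintegral => // x _; have /andP[] := key x.
rewrite -[X in _ <= _ + X](Rintegral_cst1 mu) -RintegralD//; last first.
  by apply: (@bounded_integrable _ _ 1) => // x; rewrite normr1.
apply: le_Rintegral => //; last by move=> x _; have /andP[] := key x.
apply: integrable_EFinD => //.
by apply: (@bounded_integrable _ _ 1) => // x; rewrite normr1.
Qed.

Lemma ler_invS (x y : R) : (forall N, x <= y + N.+1%:R^-1) -> x <= y.
Proof.
move=> H; apply/ler_addgt0Pr => e e0.
have [N] := ltr_add_invr e0; rewrite add0r => Ne.
by apply: le_trans (H N) _; rewrite lerD2l ltW.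
Qed.

(** A layer sum is an average of masses, so a uniform bound on the masses passes
    to it unchanged; the discretization error is then sent to zero. *)
Lemma dist_Rintegral_le mu nu h (e : R) : measurable_fun setT h ->
  (forall x, 0 <= h x <= 1) ->
  (forall A, measurable A -> `|fine (mu A) - fine (nu A)| <= e) ->
  `|\int[mu]_x h x - \int[nu]_x h x| <= e.
Proof.
move=> mh h01 mne.
have one (m1 m2 : probability T R) :
    (forall A, measurable A -> fine (m1 A) <= fine (m2 A) + e) ->
    \int[m1]_x h x <= \int[m2]_x h x + e.
  move=> me; apply: ler_invS => N.
  have /andP[_ h1] := layer_sum_approx m1 N mh h01.
  have /andP[h2 _] := layer_sum_approx m2 N mh h01.
  apply: (le_trans h1); rewrite lerD2r.
  apply: le_trans (_ : _ <= layer_sum m2 h N + e) _; last by rewrite lerD2r.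
  rewrite /layer_sum -[X in _ + X](mulKf (_ : N.+1%:R != 0)) ?pnatr_eq0//.
  rewrite -mulrDr ler_wpM2l ?invr_ge0 ?ler0n//.
  rewrite -[X in X%:R * e](card_ord N.+1) mulr_natl -sumr_const -big_split/=.
  by apply: ler_sum => i _; apply: me; exact: measurable_superlevel.
rewrite ler_norml; apply/andP; split.
  rewrite lerBrDl lerBlDr; apply: one => A mA.
  by have := mne _ mA; rewrite distrC ler_norml => /andP[_]; rewrite lerBlDl.
rewrite lerBlDl; apply: one => A mA.
by have := mne _ mA; rewrite ler_norml => /andP[_]; rewrite lerBlDl.
Qed.

End bounded_integrals.

Section localized_integrals.
Context d (T : measurableType d) (R : realType).
Implicit Types (mu nu : probability T R) (f g h : T -> R).

Lemma Rintegral_bounded_cvg mu (f_ : nat -> T -> R) f (M : R) :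
  (forall n, measurable_fun setT (f_ n)) -> measurable_fun setT f ->
  (forall n x, `|f_ n x| <= M) -> {ae mu, forall x, f_ ^~ x @ \oo --> f x} ->
  \int[mu]_x f_ n x @[n --> \oo] --> \int[mu]_x f x.
Proof.
move=> mf_ mf fM f_f.
have [|||||iF _ cF] := @dominated_convergence _ _ _ mu _ measurableT
    (fun n => EFin \o f_ n) (EFin \o f) (cst M%:E).
- by move=> n; exact/measurable_EFinP.
- exact/measurable_EFinP.
- by apply: filterS f_f => x cx _; apply/fine_cvgP; split => //; exact: nearW.
- by apply: (@bounded_integrable _ _ _ _ (cst M) `|M|) => // x.
- by apply: aeW => x n _; rewrite /= lee_fin.
apply: fine_cvg; rewrite fineK//; exact: integrable_fin_num.
Qed.

Lemma Rintegral_unit_itv mu h : measurable_fun setT h ->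
  (forall x, 0 <= h x <= 1) -> 0 <= \int[mu]_x h x <= 1.
Proof.
move=> mh h01; rewrite Rintegral_ge0/=; last by move=> x _; case/andP: (h01 x).
rewrite -[X in _ <= X](Rintegral_cst1 mu); apply: le_Rintegral => //.
- exact: unit_integrable.
- by apply: (@bounded_integrable _ _ _ _ _ 1) => // x; rewrite normr1.
- by move=> x _; case/andP: (h01 x).
Qed.

Lemma unit_mul (a c : R) : 0 <= a <= 1 -> 0 <= c <= 1 -> 0 <= a * c <= 1.
Proof.
by move=> /andP[a0 a1] /andP[c0 c1]; rewrite mulr_ge0//= mulr_ile1.
Qed.

Lemma Rintegral_localized mu (f phi : T -> R) (c e : R) :
  measurable_fun setT f -> measurable_fun setT phi ->
  (forall x, 0 <= f x <= 1) -> (forall x, 0 <= phi x <= 1) ->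
  (forall x, 0 < phi x -> `|f x - c| <= e) ->
  `|\int[mu]_x (f x * phi x) - c * \int[mu]_x phi x| <= e * \int[mu]_x phi x.
Proof.
move=> mf mphi f01 phi01 fc.
have iphi := unit_integrable mu mphi phi01.
have iM r : mu.-integrable setT (EFin \o (fun x => r * phi x)).
  exact: integrable_EFinZl.
have ifp : mu.-integrable setT (EFin \o (fun x => f x * phi x)).
  apply: unit_integrable; first exact: measurable_funM.
  by move=> x; exact: unit_mul.
have key x : c * phi x - e * phi x <= f x * phi x <= c * phi x + e * phi x.
  have /andP[p0 p1] := phi01 x.
  move: p0; rewrite le_eqVlt => /predU1P[<-|p0].
    by rewrite !mulr0 subr0 addr0 lexx.
  have := fc x p0; rewrite ler_norml => /andP[l1 l2].
  by rewrite -mulrBl -mulrDl !ler_pM2r//; apply/andP; split; lra.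
have lo : \int[mu]_x (c * phi x - e * phi x) <= \int[mu]_x (f x * phi x).
  apply: le_Rintegral => //; first exact: integrable_EFinB.
  by move=> x _; case/andP: (key x).
have up : \int[mu]_x (f x * phi x) <= \int[mu]_x (c * phi x + e * phi x).
  apply: le_Rintegral => //; first exact: integrable_EFinD.
  by move=> x _; case/andP: (key x).
rewrite RintegralB// !RintegralZl// in lo.
rewrite RintegralD// !RintegralZl// in up.
by rewrite ler_norml; apply/andP; split; lra.
Qed.

(** On the support of [phi] both [f] and [g] are [e]-close to the same constant
    [c], so each integral is [c] times the mass of [phi], up to [e] times it. *)
Lemma dist_Rintegral_localized mu nu (f g phi : T -> R) (c e : R) :
  measurable_fun setT f -> measurable_fun setT g -> measurable_fun setT phi ->
  (forall x, 0 <= f x <= 1) -> (forall x, 0 <= g x <= 1) ->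
  (forall x, 0 <= phi x <= 1) -> 0 <= c <= 1 ->
  (forall x, 0 < phi x -> `|f x - c| <= e) ->
  (forall x, 0 < phi x -> `|g x - c| <= e) ->
  `|\int[mu]_x (f x * phi x) - \int[nu]_x (g x * phi x)|
    <= (1 + e) * `|\int[mu]_x phi x - \int[nu]_x phi x|
       + (e *+ 2) * \int[nu]_x phi x.
Proof.
move=> mf mg mphi f01 g01 phi01 c01 fc gc.
have := Rintegral_localized mu mf mphi f01 phi01 fc.
have := Rintegral_localized nu mg mphi g01 phi01 gc.
have /andP[p0 _] := Rintegral_unit_itv mu mphi phi01.
have /andP[q0 _] := Rintegral_unit_itv nu mphi phi01.
move: (Rintegral mu _ _) (Rintegral nu _ _) => A B.
move: (Rintegral mu _ _) (Rintegral nu _ _) p0 q0 => p q p0 q0 Bq Ap.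
have [e0|e0] := ltrP e 0.
  have p00 : p = 0.
    by apply/eqP; rewrite eq_le p0 andbT -(ler_nM2l e0) mulr0 (le_trans _ Ap).
  have q00 : q = 0.
    by apply/eqP; rewrite eq_le q0 andbT -(ler_nM2l e0) mulr0 (le_trans _ Bq).
  move: Bq Ap; rewrite p00 q00 !mulr0 !subr0 !normr_le0 => /eqP -> /eqP ->.
  by rewrite subrr !normr0 mulr0 addr0.
have -> : A - B = (A - c * p) + (c * (p - q) - (B - c * q)) by ring.
have h1 : `|c * (p - q)| <= `|p - q|.
  by case/andP: c01 => c0 c1; rewrite normrM (ger0_norm c0) ler_piMl.
have h2 : e * p <= e * `|p - q| + e * q.
  by rewrite -mulrDr ler_wpM2l// -lerBlDr ler_norm.
apply: le_trans (ler_normD _ _) _.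
have := ler_normB (c * (p - q)) (B - c * q).
rewrite mulrDl mul1r mulr2n mulrDl.
move: Bq Ap h1 h2; move: (e * p) (e * q) (e * `|p - q|) => ep eq epq.
lra.
Qed.

End localized_integrals.

(** * The weak topology on probability measures *)

Lemma continuous_borel (S1 S2 : ptopologicalType) (f : S1 -> S2) :
  continuous f -> measurable_fun [set: borel S1] (f : borel S1 -> borel S2).
Proof.
move=> /continuousP cf.
apply: (@measurability _ _ (borel S1) (borel S2) setT _ (@open S2)) => //.
by move=> _ [B oB <-]; rewrite setTI; apply: sub_sigma_algebra; exact: cf.
Qed.

Section weak_topology.
Context (R : realType) (X : ptopologicalType).
Implicit Types (mu nu : Pr R X).

Lemma continuous_borel_measurable (f : X -> R) :
  continuous f -> measurable_fun [set: borel X] f.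
Proof.
move=> cf; apply: (measurability _ (RGenOpens.measurableE R)) => //.
move=> _ [A [a [c ->]] <-]; rewrite setTI; apply: sub_sigma_algebra.
by move/continuousP : cf; apply; exact: interval_open.
Qed.

(** A lower bound suffices because it applies both to [f] and to [- f]; the
    range is normalized by an affine change of variable. *)
Lemma Pr_filter_cvg (G : set_system (Pr R X)) (FG : Filter G) mu :
  (forall h : X -> R, continuous h -> (forall x, 0 <= h x <= 1) ->
    forall e : R, 0 < e -> G [set nu : Pr R X |
      \int[mu]_(x in [set: borel X]) h x - e
      < \int[nu]_(x in [set: borel X]) h x]) ->
  G --> mu.
Proof.
move=> H; pose I (f : X -> R) (nu : Pr R X) : R :=
  \int[nu]_(x in [set: borel X]) f x.
suff cI : forall f, bounded_continuous f -> I f nu @[nu --> G] --> I f mu.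
  apply/cvg_sup => -[f bf] B /=.
  rewrite (@nbhsE (initial_topology (I f))) => -[C [[D oD <-] Dmu] CB].
  apply: filterS CB _; apply: (cI f bf).
  by apply: open_nbhs_nbhs; split.
have {}H (f : X -> R) : bounded_continuous f -> forall e : R, 0 < e ->
    G [set nu | I f mu - e < I f nu].
  move=> [cf [M0 fM0]] e e0.
  (* [M0] may vanish, and the rescaling divides by [2 M]. *)
  pose M := M0 + 1.
  have M1 : 1 <= M by rewrite lerDr (le_trans _ (fM0 point)).
  have M2 : 0 < M *+ 2 by rewrite pmulrn_lgt0// (lt_le_trans _ M1).
  pose h x := (f x + M) / (M *+ 2).
  have ch : continuous h.
    by move=> x; apply: cvgMl; apply: cvgD; [exact: cf|exact: cvg_cst].
  have h01 x : 0 <= h x <= 1.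
    have := fM0 x; rewrite ler_norml => /andP[f1 f2].
    rewrite /h divr_ge0//=; [|rewrite /M; lra|exact: ltW].
    by rewrite ler_pdivrMr// mul1r mulr2n lerD2r (le_trans f2)// lerDl.
  have fE nu : I f nu = M *+ 2 * I h nu - M.
    have ih := unit_integrable nu (continuous_borel_measurable ch) h01.
    rewrite /I -RintegralZl// -[X in _ - X](Rintegral_cst1 nu) -RintegralB//.
    - apply: eq_Rintegral => x _.
      by rewrite /h mulrC mulfVK ?gt_eqF// addrK.
    - exact: integrable_EFinZl.
    - by apply: (@bounded_integrable _ _ _ _ _ `|M|).
  have := H h ch h01 (e / (M *+ 2)) (divr_gt0 e0 M2).
  apply: filterS => nu /=; rewrite -/(I h mu) -/(I h nu) !fE.
  rewrite -(ltr_pM2l M2) mulrBr (mulrC _ (e / _)) mulfVK ?gt_eqF//.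
  lra.
move=> f bf; apply/cvgrPdist_lt => e e0.
have bNf : bounded_continuous (fun x => - f x).
  case: bf => cf [M fM]; split; first by move=> x; apply: cvgN; exact: cf.
  by exists M => x; rewrite normrN.
have INE nu : I (fun x => - f x) nu = - I f nu.
  case: bf => cf [M fM].
  have fi : (nu : probability (borel X) R).-integrable setT (EFin \o f).
    exact: (bounded_integrable nu (continuous_borel_measurable cf) fM).
  rewrite /I -mulN1r -RintegralZl//.
  by apply: eq_Rintegral => x _; rewrite mulN1r.
apply: (@filterS _ G FG _ _ _ (filterI (H _ bf _ e0) (H _ bNf _ e0))).
move=> nu [/= h1 h2]; rewrite !INE in h2.
by rewrite /= ltr_norml; apply/andP; split; lra.
Qed.

(** An enumerated form of second countability. *)
Definition nat_base (b : nat -> set X) := (forall k, open (b k)) /\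
  forall x V, nbhs x V -> exists2 k, b k x & b k `<=` V.

Definition base_union (b : nat -> set X) (l : seq nat) : set (borel X) :=
  \bigcup_(k in [set` l]) b k.

Variable (b : nat -> set X).
Hypothesis bb : nat_base b.

Lemma base_union_open l : open (base_union b l).
Proof. by apply: bigcup_open => k _; case: bb. Qed.

Lemma open_borel (O : set X) : open O -> measurable (O : set (borel X)).
Proof. exact: sub_sigma_algebra. Qed.

Lemma base_union_measurable l : measurable (base_union b l).
Proof. by apply: open_borel; exact: base_union_open. Qed.

(** Inner regularity of open sets along finite unions of basic sets: an open set
    is the increasing union of the finite unions of the basic sets it contains. *)
Lemma base_union_approx mu (O : set X) (e : R) : open O -> 0 < e ->
  exists2 l, base_union b l `<=` O &
    fine (mu (O : set (borel X))) - e < fine (mu (base_union b l)).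
Proof.
move=> oO e0.
pose l n := [seq k <- iota 0 n | `[< b k `<=` O >]].
have lO n : base_union b (l n) `<=` O.
  by move=> x [k /=]; rewrite mem_filter => /andP[/asboolP bO _] /bO.
have UO : \bigcup_n base_union b (l n) = O.
  apply/seteqP; split=> [x [n _]|x Ox]; first exact: lO.
  have [k bkx bkO] := bb.2 x O (open_nbhs_nbhs (conj oO Ox)).
  exists k.+1 => //; exists k => //=.
  by rewrite mem_filter mem_iota add0n leq0n ltnSn !andbT; apply/asboolP.
have ndl : nondecreasing_seq (fun n => base_union b (l n)).
  move=> n m nm; apply/subsetPset => x [k /=].
  rewrite mem_filter mem_iota => /andP[bO kn] bkx; exists k => //=.
  by rewrite mem_filter bO mem_iota/= add0n (leq_trans _ nm).
have fO : mu (O : set (borel X)) \is a fin_num.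
  by apply: fin_num_measure; exact: open_borel.
have cO : mu (base_union b (l n)) @[n --> \oo] --> (fine (mu O))%:E.
  rewrite fineK// -[X in _ --> mu X]UO.
  apply: nondecreasing_cvg_mu ndl.
  - by move=> n; exact: base_union_measurable.
  - by rewrite UO; exact: open_borel.
have /cvgrPdist_lt : fine (mu (base_union b (l n))) @[n --> \oo] -->
    fine (mu O) by exact: fine_cvg cO.
move=> /(_ _ e0) [n _ /(_ n (leqnn n))/= H].
exists (l n) => //.
by have := ltr_normlW H; rewrite ltrBlDl addrC ltrBlDr addrC.
Qed.

(** The portmanteau criterion restricted to a countable family of open sets.
    Lower bounds on the masses of the finite unions of basic sets pass to all
    open sets by inner regularity, then to the integral of a continuous function
    through the layer sums of its open superlevel sets.  It is stated for filters
    in order to apply to sequences and to the neighborhoods of [mu]. *)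
Lemma cvg_base_union (G : set_system (Pr R X)) (FG : Filter G) mu :
  (forall l (e : R), 0 < e -> G [set nu : Pr R X |
     fine (mu (base_union b l)) - e < fine (nu (base_union b l))]) ->
  G --> mu.
Proof.
move=> H.
have {}H (O : set X) (e : R) : open O -> 0 < e -> G [set nu : Pr R X |
    fine (mu (O : set (borel X))) - e < fine (nu (O : set (borel X)))].
  move=> oO e0; have e20 : 0 < e / 2 by rewrite divr_gt0.
  have [l lO ml] := base_union_approx mu oO e20.
  apply: filterS (H l _ e20) => nu /= nl.
  have : fine (nu (base_union b l)) <= fine (nu (O : set (borel X))).
    rewrite fine_le ?fin_num_measure//.
    - exact: base_union_measurable.
    - exact: open_borel.
    - by apply: le_measure; rewrite ?inE//;
        [exact: base_union_measurable|exact: open_borel].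
  lra.
apply: Pr_filter_cvg => h ch h01 e e0.
have mh := continuous_borel_measurable ch.
(* Half of [e] pays for the discretization, half for the masses. *)
have [N] := ltr_add_invr (divr_gt0 e0 (ltr0Sn R 1)); rewrite add0r => Ne.
have oO i : open [set x | i.+1%:R / N.+1%:R < h x].
  rewrite (_ : mkset _ = h @^-1` `]i.+1%:R / N.+1%:R, +oo[%classic).
    by move/continuousP : ch; apply; exact: interval_open.
  by apply/seteqP; split=> x /=; rewrite in_itv/= andbT.
have e20 : 0 < e / 2 by rewrite divr_gt0.
have : G [set nu : Pr R X | forall i : 'I_N.+1,
    fine (mu ([set x | i.+1%:R / N.+1%:R < h x] : set (borel X))) - e / 2
    < fine (nu ([set x | i.+1%:R / N.+1%:R < h x] : set (borel X)))].
  by apply: filter_forall => i; exact: H.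
apply: filterS => nu /= Hnu.
have hmu : \int[mu]_(x in [set: borel X]) h x
    <= layer_sum mu h N + N.+1%:R^-1.
  by have /andP[] := layer_sum_approx mu N mh h01.
have hnu : layer_sum nu h N <= \int[nu]_(x in [set: borel X]) h x.
  by have /andP[] := layer_sum_approx nu N mh h01.
suff HL : layer_sum mu h N - e / 2 <= layer_sum nu h N.
  apply: lt_le_trans hnu; rewrite ltrBlDr; apply: le_lt_trans hmu _.
  by move: (N.+1%:R^-1) Ne => i Ne; lra.
rewrite /layer_sum -[X in _ - X](mulKf (_ : N.+1%:R != 0)) ?pnatr_eq0//.
rewrite -mulrBr ler_wpM2l ?invr_ge0 ?ler0n//.
rewrite -[X in X%:R * (e / 2)](card_ord N.+1) mulr_natl -sumr_const -sumrB.
by apply: ler_sum => i _; exact: ltW.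
Qed.

(** Countably many sets that generate the weak neighborhoods. *)
Definition rational_box (s : seq (seq nat * rat)) : set (Pr R X) :=
  [set nu | forall c, c \in s -> ratr c.2 < fine (nu (base_union b c.1))].

(** The rational boxes around [mu] generate a filter to which the criterion
    above applies, so this filter is finer than the weak neighborhoods. *)
Lemma nbhs_rational_box mu (W : set (Pr R X)) : nbhs mu W ->
  exists2 s, rational_box s mu & rational_box s `<=` W.
Proof.
pose G : set_system (Pr R X) :=
  [set W | exists2 s, rational_box s mu & rational_box s `<=` W].
have FG : Filter G.
  split.
  - by exists [::].
  - move=> A B [s smu sA] [t tmu tB]; exists (s ++ t).
      by move=> c; rewrite mem_cat => /orP[/smu|/tmu].
    by move=> nu stnu; split; [apply: sA|apply: tB] => c cs;
      apply: stnu; rewrite mem_cat cs ?orbT.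
  - by move=> A B AB [s smu sA]; exists s => //; exact: subset_trans AB.
suff : G --> mu by apply.
apply: cvg_base_union => l e e0.
have /rat_in_itvoo[q] :
    fine (mu (base_union b l)) - e < fine (mu (base_union b l)).
  by rewrite ltrBlDr ltrDl.
rewrite in_itv/= => /andP[q1 q2].
exists [:: (l, q)]; first by move=> c; rewrite inE => /eqP ->.
by move=> nu /(_ (l, q)); rewrite inE eqxx => /(_ isT) /=; exact: lt_trans.
Qed.

(** Countability of the boxes is what makes an arbitrary weakly open set
    measurable for the evaluations on finite unions of basic sets. *)
Lemma measurable_fun_Pr d (T : measurableType d) (f : T -> Pr R X) :
  (forall B : set (borel X), measurable B ->
    measurable_fun setT (fun t => (f t : probability (borel X) R) B)) ->
  measurable_fun setT (f : T -> borel (Pr R X)).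
Proof.
move=> mf; apply: (@measurability _ _ T (borel (Pr R X)) setT f
  (@open (Pr R X))) => //.
move=> _ [W oW <-]; rewrite setTI.
have -> : f @^-1` W =
    \bigcup_(s in [set s | rational_box s `<=` W]) f @^-1` rational_box s.
  apply/seteqP; split=> [t Wt|t [s sW]]; last exact: sW.
  have [s st sW] := nbhs_rational_box (open_nbhs_nbhs (conj oW Wt)).
  by exists s.
rewrite bigcup_mkcond; apply: countable_bigcupT_measurable.
  exact: countableP.
move=> s; case: ifPn => // _.
have -> : f @^-1` rational_box s = \bigcap_(c in [set` s])
    [set t | ((ratr c.2)%:E <
      (f t : probability (borel X) R) (base_union b c.1))%E].
  apply/seteqP; split=> t /= H c /= cs; have := H c cs;
    by rewrite -lte_fin fineK ?fin_num_measure//; exact: base_union_measurable.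
apply: fin_bigcap_measurable; first exact: finite_seq.
move=> c _; rewrite -[X in measurable X]setTI.
apply: emeasurable_fun_o_infty => //; apply: mf; exact: base_union_measurable.
Qed.

End weak_topology.

(** * Uniformity in weak convergence *)

Section uniform_weak_convergence.
Context (R : realType) (X : ptopologicalType).
Hypothesis crX : completely_regular_space X.

(** The function separating [x] from the complement of [V] is rescaled and
    truncated, in order to be constant near [x]. *)
Lemma bump_function (x : X) (V : set X) : nbhs x V ->
  exists psi : X -> R, [/\ continuous psi, forall y, 0 <= psi y <= 1,
    \forall y \near x, psi y = 1 & forall y, 0 < psi y -> V y].
Proof.
rewrite nbhsE => -[W [oW Wx] WV].
have sepx : uniform_separator [set x] (~` W).
  by apply: crX => /=; [exact: open_closedC|exact].
have [f [cf f01 f0 f1]] := (@uniform_separatorP X R _ _).1 sepx.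
have {}f01 y : 0 <= f y <= 1.
  have : (f @` setT) (f y) by exists y.
  by move=> /f01 /=; rewrite in_itv.
have fx : f x = 0 by apply: f0; exists x.
exists (fun y => Num.min 1 (2 * (1 - f y))); split.
- move=> y; have c2 : {for y, continuous (fun t => 2 * (1 - f t))}.
    apply: cvgM; first exact: cvg_cst.
    by apply: cvgB; [exact: cvg_cst|exact: cf].
  have c1 : {for y, continuous (cst (1 : R) : X -> R)} by exact: cvg_cst.
  exact: (continuous_min c1 c2).
- move=> y; have /andP[fy0 fy1] := f01 y.
  by rewrite ge_min lexx /= le_min ler01 /=; lra.
- have : \forall y \near x, f y < 2^-1.
    have := cf x; rewrite /continuous_at fx => /cvgrPdist_lt /(_ 2^-1).
    rewrite invr_gt0 ltr0n => /(_ isT); apply: filterS => y.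
    by rewrite sub0r normrN; exact: le_lt_trans (ler_norm _).
  apply: filterS => y fy; apply/min_idPl; lra.
- move=> y; rewrite lt_min ltr01/= pmulr_rgt0// subr_gt0 => fy.
  apply: WV; apply: contrapT => nWy.
  have fy1 : f y = 1 by apply: f1; exists y.
  by rewrite fy1 ltxx in fy.
Qed.

Variable b : nat -> set X.
Hypothesis bb : nat_base b.

(** Weak convergence is uniform over asymptotically equicontinuous families of
    functions.  Countably many bump functions [psi k], each supported where the
    [f n] and [g n] are nearly constant, give the partition of unity
    [psi k * \prod_(i < k) (1 - psi i)].  Against each of its members the two
    integrals differ by little, since the mass of the member converges; the
    remainder [\prod_(i < J) (1 - psi i)] has small [z]-mass for large [J], hence
    small [z_ n]-mass for large [n]. *)
Lemma uniform_weak_cvg (z_ : nat -> Pr R X) (z : Pr R X)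
    (f g : nat -> X -> R) :
  z_ @ \oo --> z ->
  (forall n, measurable_fun [set: borel X] (f n)) ->
  (forall n, measurable_fun [set: borel X] (g n)) ->
  (forall n x, 0 <= f n x <= 1) -> (forall n x, 0 <= g n x <= 1) ->
  (forall x (e : R), 0 < e -> exists V N, nbhs x V /\
    forall n y, (N <= n)%N -> V y ->
      `|f n y - g n x| <= e /\ `|g n y - g n x| <= e) ->
  \int[z_ n]_(x in [set: borel X]) f n x
    - \int[z]_(x in [set: borel X]) g n x @[n --> \oo] --> (0 : R).
Proof.
move=> zz mf mg f01 g01 loc; apply/cvgrPdist_le => e5 e50.
(* Two [e] from the partition of unity, one from the masses of its members,
   two from the remainder. *)
pose e : R := e5 / 5; have e0 : 0 < e by rewrite divr_gt0.
pose good (psi : X -> R) := [/\ continuous psi, forall y, 0 <= psi y <= 1 &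
  exists x N, forall n y, (N <= n)%N -> 0 < psi y ->
      `|f n y - g n x| <= e /\ `|g n y - g n x| <= e].
have : forall k, exists psi : X -> R, good psi /\
    ((exists2 psi', good psi' & forall y, b k y -> psi' y = 1) ->
      forall y, b k y -> psi y = 1).
  move=> k; have [[psi gpsi psi1]|no] :=
    pselect (exists2 psi', good psi' & forall y, b k y -> psi' y = 1).
    by exists psi.
  exists (cst 0); split => //; split.
  - by move=> x; exact: cvg_cst.
  - by move=> y; rewrite lexx ler01.
  - by exists point, 0%N => n y _; rewrite ltxx.
move=> /choice[psi psiP].
have gpsi k : good (psi k) by have [] := psiP k.
have psi1 x : exists k, psi k x = 1.
  have [V [N [xV VN]]] := loc x e e0.
  have [phi [cphi phi01 phi1 phiV]] := bump_function xV.
  have [k bkx bk] := bb.2 x _ phi1.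
  exists k; apply: (psiP k).2 => //; exists phi => //; split=> //.
  by exists x, N => n y Nn /phiV; exact: VN.
pose r J x := \prod_(k < J) (1 - psi k x).
have r01 J x : 0 <= r J x <= 1.
  rewrite /r; elim: J => [|J IH]; first by rewrite big_ord0 ler01 lexx.
  rewrite big_ord_recr/=; apply: unit_mul => //.
  by have [_ /(_ x)/andP[]] := gpsi J; rewrite subr_ge0 gerBl => -> ->.
have cr J : continuous (r J).
  rewrite /r; elim: J => [|J IH] x.
    under eq_fun do rewrite big_ord0.
    exact: cvg_cst.
  under eq_fun do rewrite big_ord_recr.
  apply: cvgM; first exact: IH.
  by apply: cvgB; [exact: cvg_cst|have [+ _ _] := gpsi J; exact].
have mr J : measurable_fun [set: borel X] (r J).
  exact: continuous_borel_measurable.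
pose E (nu : Pr R X) (h : X -> R) : R := \int[nu]_(x in [set: borel X]) h x.
have zE (h : X -> R) : continuous h -> (forall x, 0 <= h x <= 1) ->
    E (z_ n) h @[n --> \oo] --> E z h.
  move=> ch h01; apply: ((Pr_cvgP z_ z).1 zz); split=> //.
  by exists 1 => x; have /andP[h0 h1] := h01 x; rewrite ger0_norm.
have Er : E z (r J) @[J --> \oo] --> (0 : R).
  rewrite -(Rintegral_cst1 (z : probability (borel X) R) 0).
  apply: (@Rintegral_bounded_cvg _ _ _ _ _ _ 1) => //.
    by move=> J x; have /andP[? ?] := r01 J x; rewrite ger0_norm.
  apply: aeW => x; have [k pk] := psi1 x.
  apply: cvg_near_cst; exists k.+1 => // J /= kJ.
  by rewrite /r (bigD1 (Ordinal kJ))//= pk subrr mul0r.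
have fr01 n J x : 0 <= f n x * r J x <= 1 by exact: unit_mul.
have gr01 n J x : 0 <= g n x * r J x <= 1 by exact: unit_mul.
have r'01 J x : 0 <= 1 - r J x <= 1.
  by have /andP[? ?] := r01 J x; apply/andP; split; lra.
have mr' J : measurable_fun [set: borel X] (fun x => 1 - r J x).
  by apply: measurable_funB.
have ED nu (h k : X -> R) : measurable_fun [set: borel X] h ->
    measurable_fun [set: borel X] k ->
    (forall x, 0 <= h x <= 1) -> (forall x, 0 <= k x <= 1) ->
    E nu (fun x => h x + k x) = E nu h + E nu k.
  by move=> mh mk h01 k01; rewrite /E RintegralD//; exact: unit_integrable.
have rS J x : 1 - r J.+1 x = (1 - r J x) + psi J x * r J x.
  by rewrite /r big_ord_recr/=; ring.
(* [phi] below is the [J]-th member of the partition; an arbitrary [delta]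
   absorbs the errors of the finitely many steps of the induction. *)
have step J (delta : R) : 0 < delta -> \forall n \near \oo,
    `|E (z_ n) (fun x => f n x * (1 - r J x))
      - E z (fun x => g n x * (1 - r J x))|
    <= (e *+ 2) * E z (fun x => 1 - r J x) + delta.
  elim: J delta => [|J IH] delta d0.
    apply: nearW => n.
    have r0 (h : X -> R) : (fun x => h x * (1 - r 0%N x)) = cst 0.
      by apply/funext => x; rewrite /r big_ord0 subrr mulr0.
    rewrite !r0 /E !Rintegral_cst1 subrr normr0.
    apply: addr_ge0; last exact: ltW.
    apply: mulr_ge0; first by rewrite mulrn_wge0// ltW.
    by apply: Rintegral_ge0 => x _; case/andP: (r'01 0%N x).
  have [cpsi psi01 [x0 [N psiN]]] := gpsi J.
  pose phi x := psi J x * r J x.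
  have phi01 x : 0 <= phi x <= 1 by exact: unit_mul.
  have cphi : continuous phi.
    by move=> x; apply: cvgM; [exact: cpsi|exact: cr].
  have mphi := continuous_borel_measurable cphi.
  have phipsi x : 0 < phi x -> 0 < psi J x.
    rewrite /phi => p0; rewrite lt_neqAle; case/andP: (psi01 x) => -> _.
    by rewrite andbT; apply/eqP => p00; rewrite -p00 mul0r ltxx in p0.
  have d20 : 0 < delta / 2 by rewrite divr_gt0.
  have e10 : 0 < 1 + e by rewrite addr_gt0.
  have dist_phi : \forall n \near \oo,
      `|E z phi - E (z_ n) phi| <= delta / 2 / (1 + e).
    by move/cvgrPdist_le : (zE phi cphi phi01); apply; rewrite divr_gt0.
  have split_r (nu : Pr R X) (h : X -> R) : measurable_fun [set: borel X] h ->
      (forall x, 0 <= h x <= 1) ->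
      E nu (fun x => h x * (1 - r J.+1 x)) =
      E nu (fun x => h x * (1 - r J x)) + E nu (fun x => h x * phi x).
    move=> mh h01; rewrite -ED//.
    - by congr E; apply/funext => x; rewrite rS mulrDr.
    - exact: measurable_funM.
    - exact: measurable_funM.
    - by move=> x; exact: unit_mul.
    - by move=> x; exact: unit_mul.
  have EE : E z (fun x => 1 - r J.+1 x) = E z (fun x => 1 - r J x) + E z phi.
    by rewrite -ED//; congr E; apply/funext => x; exact: rS.
  near=> n.
  rewrite !split_r// EE.
  have IHn : `|E (z_ n) (fun x => f n x * (1 - r J x))
      - E z (fun x => g n x * (1 - r J x))|
    <= (e *+ 2) * E z (fun x => 1 - r J x) + delta / 2.
    by near: n; exact: IH.
  have Nn : (N <= n)%N by near: n; exists N.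
  have fgphi : `|E (z_ n) (fun x => f n x * phi x)
      - E z (fun x => g n x * phi x)|
    <= (1 + e) * `|E (z_ n) phi - E z phi| + (e *+ 2) * E z phi.
    apply: (@dist_Rintegral_localized _ _ _ _ _ _ _ _ (g n x0)) => //.
    - by move=> x /phipsi /(psiN n x Nn)[].
    - by move=> x /phipsi /(psiN n x Nn)[].
  have phin : (1 + e) * `|E (z_ n) phi - E z phi| <= delta / 2.
    rewrite mulrC -ler_pdivlMr// distrC.
    by near: n.
  move: IHn fgphi phin.
  move: (E (z_ n) (fun x => f n x * (1 - r J x))) => A.
  move: (E z (fun x => g n x * (1 - r J x))) => B.
  move: (E (z_ n) (fun x => f n x * phi x)) => A'.
  move: (E z (fun x => g n x * phi x)) => B'.
  move: (_ * `|_|) => q.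
  rewrite mulrDr.
  move: (e *+ 2 * E z phi) (e *+ 2 * _) => s t h1 h2 h3.
  have -> : A + A' - (B + B') = (A - B) + (A' - B') by ring.
  apply: le_trans (ler_normD _ _) _.
  lra.
have {}Er : \forall J \near \oo, E z (r J) <= e.
  move/cvgrPdist_le : Er => /(_ e e0); apply: filterS => J.
  by rewrite sub0r normrN; exact: le_trans (ler_norm _).
have [J _ /(_ J (leqnn J))/= Jr] := Er.
have rest (nu : Pr R X) (h : X -> R) : measurable_fun [set: borel X] h ->
      (forall x, 0 <= h x <= 1) ->
      [/\ E nu h = E nu (fun x => h x * (1 - r J x))
             + E nu (fun x => h x * r J x),
        0 <= E nu (fun x => h x * r J x) &
        E nu (fun x => h x * r J x) <= E nu (r J)].
  move=> mh h01.
  have hr01 x : 0 <= h x * r J x <= 1 by exact: unit_mul.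
  have mhr : measurable_fun [set: borel X] (fun x => h x * r J x).
    exact: measurable_funM.
  split.
  - rewrite -ED//.
    + by congr E; apply/funext => x; ring.
    + exact: measurable_funM.
    + by move=> x; exact: unit_mul.
  - by case/andP: (Rintegral_unit_itv nu mhr hr01).
  - apply: le_Rintegral => //; [exact: unit_integrable|exact: unit_integrable|].
    move=> x _; case/andP: (h01 x) => h0 h1; case/andP: (r01 J x) => r0 r1.
    by rewrite ler_piMl.
have dist_r : \forall n \near \oo, `|E z (r J) - E (z_ n) (r J)| <= e.
  by move/cvgrPdist_le : (zE (r J) (cr J) (r01 J)); exact.
have e2r : (e *+ 2) * E z (fun x => 1 - r J x) <= e *+ 2.
  apply: ler_piMr; first by rewrite mulrn_wge0// ltW.
  by case/andP: (Rintegral_unit_itv z (mr' J) (r'01 J)).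
near=> n.
have stepn : `|E (z_ n) (fun x => f n x * (1 - r J x))
      - E z (fun x => g n x * (1 - r J x))|
    <= (e *+ 2) * E z (fun x => 1 - r J x) + e.
  by near: n; exact: step.
have distn : `|E z (r J) - E (z_ n) (r J)| <= e by near: n.
have e5E : e5 = e *+ 2 + e + e *+ 2 by rewrite /e; field.
have [fE f0 fr] := rest (z_ n) (f n) (mf n) (f01 n).
have [gE g0 gr] := rest z (g n) (mg n) (g01 n).
rewrite sub0r normrN e5E -/(E (z_ n) (f n)) -/(E z (g n)) fE gE.
move: stepn e2r distn f0 fr g0 gr Jr.
move: (E (z_ n) (fun x => f n x * (1 - r J x))) => A.
move: (E z (fun x => g n x * (1 - r J x))) => B.
move: (E (z_ n) (fun x => f n x * r J x)) => A'.
move: (E z (fun x => g n x * r J x)) => B'.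
move: (E z (r J)) (E (z_ n) (r J)) => p q.
move: (_ * E _ _) => s.
rewrite !ler_norml => /andP[h1 h2] h3 /andP[h4 h5] h6 h7 h8 h9 h10.
rewrite !mulr2n in h3 *.
by apply/andP; split; lra.
Unshelve. all: by end_near.
Qed.

End uniform_weak_convergence.

(** * Subspaces of Euclidean spaces *)

Section euclidean_subspaces.
Context (R : realType) (n : nat) (A : set 'rV[R]_n) (A0 : A !=set0).
Local Notation S := (subsp A0).

Lemma subsp_completely_regular : completely_regular_space S.
Proof. exact: (@uniform_completely_regular R (set_type A)). Qed.

(** The traces of the balls with rational centers and radii [1 / (j + 1)]. *)
Lemma subsp_nat_base : exists b : nat -> set S, nat_base b.
Proof.
pose ballq (c : 'rV[rat]_n * nat) : set S :=
  sval @^-1` (ball (map_mx ratr c.1 : 'rV[R]_n) c.2.+1%:R^-1)°.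
exists (fun k => if unpickle k is Some c then ballq c else set0); split.
  move=> k; case: unpickle => [c|]; last exact: open0.
  have /continuousP : continuous (sval : S -> 'rV[R]_n).
    exact: (@initial_continuous (set_type A) 'rV[R]_n set_val).
  by apply; exact: open_interior.
move=> x V.
rewrite nbhsE => -[_ [[W oW <-] Wx] WV].
have /nbhs_ballP[e /= e0 eW] : nbhs (sval x) W by exact: open_nbhs_nbhs.
have [j] := ltr_add_invr (divr_gt0 e0 (ltr0Sn R 1)); rewrite add0r => je.
pose d : R := j.+1%:R^-1.
have d0 : 0 < d by rewrite invr_gt0 ltr0n.
have /choice[q qP] : forall i, exists q : rat,
    `|ratr q - sval x ord0 i| < d / 2.
  move=> i; have /rat_in_itvoo[q] : sval x ord0 i < sval x ord0 i + d / 2.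
    by rewrite ltrDl divr_gt0.
  rewrite in_itv/= => /andP[q1 q2]; exists q.
  by rewrite ger0_norm; [rewrite ltrBlDl|rewrite subr_ge0 ltW].
pose Q : 'rV[rat]_n := \row_i q i.
have Qx : ball (map_mx ratr Q : 'rV[R]_n) (d / 2) (sval x).
  split; first by rewrite divr_gt0.
  by move=> i i'; rewrite (ord1 i) !mxE; exact: qP.
have qx : ballq (Q, j) x.
  apply/nbhs_ballP; exists (d / 2); first by rewrite /= divr_gt0.
  by move=> y xy; have := ball_triangle Qx xy; rewrite -splitr.
exists (pickle (Q, j)); rewrite pickleK => // y yq; apply: WV; apply: eW.
have {}yq := interior_subset yq.
apply: le_ball (ball_triangle (ball_sym Qx) yq).
rewrite /= -/d in je *; lra.
Qed.

End euclidean_subspaces.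

(** * Total variation and the joint law *)

Section total_variation.
Context (R : realType).

Lemma le_tv_norm d (T : measurableType d) (mu nu : probability T R)
    (B : set T) : measurable B ->
  `|fine (mu B) - fine (nu B)| <= tv_norm mu nu.
Proof.
move=> mB; rewrite /tv_norm; set D := (X in sup X).
have D1 : has_ubound D.
  exists 1 => _ [C mC <-].
  have p1 (m : probability T R) : 0 <= fine (m C) <= 1.
    rewrite fine_ge0//= -lee_fin fineK ?fin_num_measure//.
    exact: probability_le1.
  have /andP[? ?] := p1 mu; have /andP[? ?] := p1 nu.
  by rewrite ler_norml; apply/andP; split; lra.
have DB : D `|fine (mu B) - fine (nu B)| by exists B.
have BD : `|fine (mu B) - fine (nu B)| <= sup D by exact: ub_le_sup.
rewrite mulr2n mulrDl mul1r (le_trans BD)// lerDl.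
exact: le_trans (normr_ge0 _) BD.
Qed.

Context (X U : ptopologicalType) (b : nat -> set X) (bb : nat_base b).
Variable T : stoch R (X * U)%type X.
Hypothesis Tcont : tv_continuous T.

(** Upgrades sequential continuity to a neighborhood that is uniform in [B] and
    in large [n]: otherwise, points in smaller and smaller neighborhoods of [x]
    would form a sequence contradicting continuity. *)
Lemma tv_locally_uniform (u_ : nat -> U) (u : U) (x : X) (e : R) :
  u_ @ \oo --> u -> 0 < e -> exists V N, nbhs x V /\
    forall n y, (N <= n)%N -> V y -> forall B : set (borel X), measurable B ->
      `|fine (kpr T (y, u_ n) B) - fine (kpr T (x, u) B)| <= e.
Proof.
move=> uu e0; apply: contrapT => bad.
(* [V k] is the intersection of those of the first [k + 1] basic sets that
   contain [x]. *)
pose V k : set X := [set y | forall i : 'I_k.+1, b i x -> b i y].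
have xV k : nbhs x (V k).
  apply: filter_forall => i; have [bix|nbix] := pselect (b i x).
    by apply: filterS (open_nbhs_nbhs (conj (bb.1 i) bix)) => y.
  exact: nearW.
have /choice[w wP] : forall k, exists w : nat * X * set (borel X),
    [/\ (k <= w.1.1)%N, V k w.1.2, measurable w.2 &
      e < `|fine (kpr T (w.1.2, u_ w.1.1) w.2) - fine (kpr T (x, u) w.2)|].
  move=> k; apply: contrapT => none; apply: bad; exists (V k), k.
  split=> // m y km Vy B mB; rewrite leNgt; apply/negP => eB.
  by apply: none; exists (m, y, B).
have cw : (fun k => ((w k).1.2, u_ (w k).1.1)) @ \oo --> (x, u).
  apply: cvg_pair => /=.
    move=> W /(bb.2 x)[i bix iW]; exists i => // k /= ik; apply: iW.
    have [_ Vk _ _] := wP k.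
    by have := Vk (Ordinal (ik : (i < k.+1)%N)); exact.
  move=> W /uu[N _ NW]; exists N => // k /= Nk; apply: NW => /=.
  by have [kw _ _ _] := wP k; exact: leq_trans kw.
have /cvgrPdist_lt /(_ e e0)[k _ /(_ k (leqnn k))/=] := Tcont cw.
apply/negP; rewrite -leNgt sub0r normrN.
have [_ _ mB /ltW eB] := wP k.
by rewrite (le_trans eB)// (le_trans (le_tv_norm _ _ mB))// ler_norm.
Qed.

End total_variation.

Section joint_law.
Context (R : realType) (X U Y : ptopologicalType).
Variables (T : stoch R (X * U)%type X) (Q : stoch R X Y).

(* Conditional probabilities of [A] given the next state ([inner]) and given
   the previous state ([outer]). *)
Let inner (A : set (borel X * borel Y)) (x1 : X) : R :=
  fine (Q x1 (xsection A x1)).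

Let inner_le1 A x1 : measurable A -> (Q x1 (xsection A x1) <= 1)%E.
Proof.
move=> mA; apply: (probability_le1 (kat Q x1)).
exact: measurable_xsection.
Qed.

Let innerE A x1 : measurable A -> Q x1 (xsection A x1) = (inner A x1)%:E.
Proof.
move=> mA; rewrite /inner fineK// ge0_fin_numE//.
by rewrite (le_lt_trans (inner_le1 _ mA))// ltry.
Qed.

Let inner01 A x1 : measurable A -> 0 <= inner A x1 <= 1.
Proof.
move=> mA; rewrite -!lee_fin -innerE// inner_le1//.
by rewrite measure_ge0.
Qed.

Let measurable_inner A : measurable A ->
  measurable_fun [set: borel X] (inner A).
Proof.
move=> mA; apply: measurableT_comp => //.
by apply: measurable_fun_xsection_finite_kernel; rewrite inE.
Qed.

Let outer (u : U) A (x0 : X) : R :=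
  \int[kpr T (x0, u)]_(x1 in [set: borel X]) inner A x1.

Let outerE u A x0 : measurable A ->
  (\int[kpr T (x0, u)]_x1 Q x1 (xsection A x1) = (outer u A x0)%:E)%E.
Proof.
move=> mA; under eq_integral do rewrite innerE//.
rewrite /outer /Rintegral fineK//; apply: integrable_fin_num => //.
by apply: unit_integrable; [exact: measurable_inner|move=> x; exact: inner01].
Qed.

Let outer01 u A x0 : measurable A -> 0 <= outer u A x0 <= 1.
Proof.
by move=> mA; apply: Rintegral_unit_itv;
  [exact: measurable_inner|move=> x; exact: inner01].
Qed.

Let measurable_outer u A : measurable A ->
  measurable_fun [set: borel X] (outer u A).
Proof.
move=> mA; apply/measurable_EFinP.
rewrite (_ : _ \o _ = fun x0 => \int[kpr T (x0, u)]_x1 (inner A x1)%:E)%E.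
  apply: (@measurable_fun_integral_kernel _ _ _ _ _
    (fun x0 : borel X => T (x0, u))) => //.
  - move=> B mB; apply: (measurableT_comp (measurable_kernel T _ mB)).
    exact: measurable_pair_snd.
  - by move=> x; rewrite lee_fin; case/andP: (inner01 x mA).
  - by apply/measurable_EFinP; exact: measurable_inner.
apply/funext => x0; rewrite /= -outerE//.
by apply: eq_integral => x1 _; rewrite innerE.
Qed.

Let jointE z u A : measurable A ->
  fine (joint T Q z u A) = \int[z]_(x0 in [set: borel X]) outer u A x0.
Proof.
move=> mA; rewrite /joint /Rintegral; congr fine.
by apply: eq_integral => x0 _; rewrite outerE.
Qed.

Hypothesis crX : completely_regular_space X.
Variables (b : nat -> set X) (bb : nat_base b).
Hypothesis Tcont : tv_continuous T.

(** Uniformity in the set: choosing for each [n] a set [A n] that violates the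
    bound, if there is one, reduces it to the sequences [outer (u_ n) (A n)] and
    [outer u (A n)].  These are covered by [uniform_weak_cvg], because the bounds
    of [tv_locally_uniform] do not depend on the set. *)
Lemma joint_tv_continuous (z_ : nat -> Pr R X) (z : Pr R X)
    (u_ : nat -> U) (u : U) (e : R) :
  z_ @ \oo --> z -> u_ @ \oo --> u -> 0 < e ->
  \forall n \near \oo, forall A, measurable A ->
    `|fine (joint T Q (z_ n) (u_ n) A) - fine (joint T Q z u A)| <= e.
Proof.
move=> zz uu e0.
have /choice[A AP] : forall n, exists A : set (borel X * borel Y),
    measurable A /\ forall B, measurable B ->
    e < `|fine (joint T Q (z_ n) (u_ n) B) - fine (joint T Q z u B)| ->
    e < `|fine (joint T Q (z_ n) (u_ n) A) - fine (joint T Q z u A)|.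
  move=> n; have [[A mA eA]|no] := pselect (exists2 A, measurable A &
    e < `|fine (joint T Q (z_ n) (u_ n) A) - fine (joint T Q z u A)|).
    by exists A.
  exists set0; split; first exact: measurable0.
  by move=> B mB eB; exfalso; apply: no; exists B.
have mA n : measurable (A n) by have [] := AP n.
have loc x (d : R) : 0 < d -> exists V N, nbhs x V /\
    forall n y, (N <= n)%N -> V y ->
      `|outer (u_ n) (A n) y - outer u (A n) x| <= d /\
      `|outer u (A n) y - outer u (A n) x| <= d.
  move=> d0.
  have [V [N [xV VN]]] := tv_locally_uniform bb Tcont x uu d0.
  have [W [M [xW WM]]] := tv_locally_uniform bb Tcont x (cvg_cst u) d0.
  exists (V `&` W), (maxn N M); split; first exact: filterI.
  move=> n y; rewrite geq_max => /andP[Nn Mn] [Vy Wy]; split.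
  - apply: dist_Rintegral_le.
    + exact: measurable_inner.
    + by move=> x1; exact: inner01.
    + by move=> B mB; exact: (VN n y Nn Vy B mB).
  - apply: dist_Rintegral_le.
    + exact: measurable_inner.
    + by move=> x1; exact: inner01.
    + by move=> B mB; exact: (WM n y Mn Wy B mB).
have := uniform_weak_cvg crX bb zz
  (fun n => measurable_outer (u_ n) (mA n))
  (fun n => measurable_outer u (mA n))
  (fun n x => outer01 (u_ n) x (mA n)) (fun n x => outer01 u x (mA n)) loc.
move/cvgrPdist_lt => /(_ e e0); apply: filterS => n.
rewrite sub0r normrN -(jointE (z_ n) (u_ n) (mA n)) -(jointE z u (mA n)).
move=> lte B mB; rewrite leNgt; apply/negP => eB.
by have := (AP n).2 B mB eB; rewrite ltNge (ltW lte).
Qed.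

End joint_law.

(** * Almost everywhere convergence and densities *)

Section almost_everywhere.
Context d (T : measurableType d) (R : realType) (P : probability T R).

(** The sum of the [h j] is integrable, hence almost everywhere finite. *)
Lemma ae_cvg0_geometric (h : nat -> T -> R) :
  (forall j, measurable_fun setT (h j)) -> (forall j x, 0 <= h j x <= 1) ->
  (forall j, \int[P]_x h j x <= 1 / (2 ^ j.+1)%:R) ->
  {ae P, forall x, h ^~ x @ \oo --> (0 : R)}.
Proof.
move=> mh h01 hj.
have h0 j x : (0 <= (h j x)%:E)%E by rewrite lee_fin; case/andP: (h01 j x).
pose S x : \bar R := (\sum_(j <oo) (h j x)%:E)%E.
have iS : P.-integrable setT S.
  apply/integrableP; split.
    apply: ge0_emeasurable_sum => [j x _ _|j _]; first exact: h0.
    exact/measurable_EFinP.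
  rewrite (eq_integral S); last first.
    by move=> x _; rewrite gee0_abs// nneseries_ge0.
  rewrite integral_nneseries//; last by move=> j; exact/measurable_EFinP.
  apply: (@le_lt_trans _ _ 1%:E%E); last exact: ltry.
  apply: le_trans (@epsilon_trick0 R 1 xpredT ler01).
  apply: lee_nneseries => [j _ _|j _]; first exact: integral_ge0.
  have := hj j; rewrite -lee_fin /Rintegral fineK//.
  by apply: integrable_fin_num => //; exact: unit_integrable.
apply: filterS (integrable_ae measurableT iS) => x /(_ I) fS.
have : cvgn (series (h ^~ x)).
  apply: nondecreasing_is_cvgn.
    by apply: nondecreasing_series => j _ _; case/andP: (h01 j x).
  exists (fine (S x)) => _ [m _ <-]; rewrite /series/= -lee_fin fineK//.
  by rewrite -sumEFin; apply: nneseries_lim_ge => j _ _; exact: h0.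
exact: cvg_series_cvg_0.
Qed.

(** The [j]-th term of the subsequence controls the first [j + 1] functions at
    rate [2 ^- (j + 1)], so that one subsequence serves all [k]. *)
Lemma ae_cvg_subseq (h_ : nat -> nat -> T -> R) (h : nat -> T -> R)
    (D : set nat) :
  (forall n k, measurable_fun setT (h_ n k)) ->
  (forall k, measurable_fun setT (h k)) ->
  (forall n k x, 0 <= h_ n k x <= 1) -> (forall k x, 0 <= h k x <= 1) ->
  (forall k, \int[P]_x `|h_ n k x - h k x| @[n --> \oo] --> (0 : R)) ->
  (forall N, exists2 n, (N <= n)%N & D n) ->
  exists s : nat -> nat, [/\ s @ \oo --> \oo, forall j, D (s j) &
    {ae P, forall x, forall k, h_ (s j) k x @[j --> \oo] --> h k x}].
Proof.
move=> mh_ mh h_01 h01 hh DD.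
have half_gt0 (j : nat) : (0 : R) < 1 / (2 ^ j.+1)%:R.
  by rewrite divr_gt0// ltr0n expn_gt0.
have /choice[s sP] : forall j, exists n, [/\ (j <= n)%N, D n &
    forall k : 'I_j.+1, \int[P]_x `|h_ n k x - h k x| <= 1 / (2 ^ j.+1)%:R].
  move=> j.
  have [N _ HN] : \forall n \near \oo, forall k : 'I_j.+1,
      \int[P]_x `|h_ n k x - h k x| <= 1 / (2 ^ j.+1)%:R.
    apply: filter_forall => k.
    move/cvgrPdist_le : (hh k) => /(_ _ (half_gt0 j)).
    by apply: filterS => n; rewrite sub0r normrN; exact: le_trans (ler_norm _).
  have [n] := DD (maxn N j); rewrite geq_max => /andP[Nn jn] Dn.
  by exists n; split => // k; exact: HN.
exists s; split.
- move=> W [N _ NW]; exists N => // j /= Nj; apply: NW => /=.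
  by have [js _ _] := sP j; exact: leq_trans js.
- by move=> j; have [] := sP j.
apply: ae_foralln => k.
have : {ae P, forall x,
    `|h_ (s (j + k)%N) k x - h k x| @[j --> \oo] --> (0 : R)}.
  apply: (ae_cvg0_geometric (h := fun j x => `|h_ (s (j + k)%N) k x - h k x|)).
  - by move=> j; apply: measurableT_comp => //; exact: measurable_funB.
  - move=> j x; rewrite normr_ge0/= ler_norml.
    have /andP[? ?] := h_01 (s (j + k)%N) k x; have /andP[? ?] := h01 k x.
    by apply/andP; split; lra.
  - move=> j; have [_ _ H] := sP (j + k)%N.
    have kj : (k < (j + k).+1)%N by rewrite ltnS leq_addl.
    apply: (le_trans (H (Ordinal kj))).
    rewrite ler_pM2l// lef_pV2 ?posrE ?ltr0n ?expn_gt0// ler_nat.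
    by rewrite leq_exp2l// ltnS leq_addr.
apply: filterS => x cx.
(* [h_ k] is controlled from the [k]-th term of the subsequence on. *)
rewrite -(cvg_shiftn k).
apply/cvgrPdist_lt => e e0; move/cvgrPdist_lt : cx => /(_ e e0).
by apply: filterS => j; rewrite sub0r normrN normr_id distrC.
Qed.

End almost_everywhere.

Section disintegration_distance.
Context d (T : measurableType d) (R : realType).

(** The [L^1] distance is the sum of the differences of the integrals over the
    set where [h <= h'] and over its complement.  Each of them is at most [2 * e]:
    one [e] for replacing [P] by [P'] in the integral of [h'], one [e] for then
    comparing it with the integral of [h] against [P]. *)
Lemma L1_dist_densities (P' P : probability T R) (h' h : T -> R) (e : R) :
  measurable_fun setT h' -> measurable_fun setT h ->
  (forall y, 0 <= h' y <= 1) -> (forall y, 0 <= h y <= 1) ->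
  (forall C, measurable C -> `|fine (P' C) - fine (P C)| <= e) ->
  (forall C, measurable C ->
    `|\int[P']_(y in C) h' y - \int[P]_(y in C) h y| <= e) ->
  \int[P]_y `|h' y - h y| <= 4 * e.
Proof.
move=> mh' mh h'01 h01 PP hh.
have restr01 C (k : T -> R) : (forall y, 0 <= k y <= 1) ->
    forall y, 0 <= (k \_ C) y <= 1.
  by move=> k01 y; rewrite patchE; case: ifP; rewrite ?lexx ?ler01.
have mrestr C (k : T -> R) : measurable C -> measurable_fun setT k ->
    measurable_fun setT (k \_ C).
  move=> mC mk; apply/(measurable_restrictT _ mC); exact: measurable_funS mk.
have key C : measurable C ->
    `|\int[P]_(y in C) h' y - \int[P]_(y in C) h y| <= 2 * e.
  move=> mC.
  have := dist_Rintegral_le (mrestr C _ mC mh') (restr01 C _ h'01) PP.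
  rewrite -!Rintegral_mkcond; have := hh C mC.
  rewrite !ler_norml => /andP[? ?] /andP[? ?]; apply/andP; split; lra.
have i'C C : measurable C -> P.-integrable C (EFin \o h').
  by move=> mC; have := unit_integrable P mh' h'01; exact: integrableS.
have iC C : measurable C -> P.-integrable C (EFin \o h).
  by move=> mC; have := unit_integrable P mh h01; exact: integrableS.
pose C := [set y | h y <= h' y].
have mC : measurable C.
  rewrite (_ : C = [set y | 0 <= (h' \- h) y]); last first.
    by apply/seteqP; split=> y /=; rewrite subr_ge0.
  rewrite -[X in measurable X]setTI; apply: measurable_fun_le => //.
  exact: measurable_funB.
have mC' : measurable (~` C) by exact: measurableC.
have iabs : P.-integrable setT (EFin \o (fun y => `|h' y - h y|)).
  apply: unit_integrable.
    by apply: measurableT_comp => //; exact: measurable_funB.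
  move=> y; rewrite normr_ge0/= ler_norml.
  have /andP[? ?] := h'01 y; have /andP[? ?] := h01 y.
  by apply/andP; split; lra.
rewrite -(setvU C) setUC Rintegral_setU//; last 2 first.
- by rewrite setUC setvU.
- by apply/disj_setPS; rewrite setICr.
rewrite (@eq_Rintegral _ _ _ P C (fun y => h' y - h y)); last first.
  by move=> y; rewrite inE /C/= => hy; rewrite ger0_norm// subr_ge0.
rewrite (@eq_Rintegral _ _ _ P (~` C) (fun y => h y - h' y)); last first.
  move=> y; rewrite inE /C/= => /negP; rewrite -ltNge => hy.
  by rewrite distrC ger0_norm// subr_ge0 ltW.
rewrite !RintegralB//; [|exact: iC|exact: i'C|exact: i'C|exact: iC].
have := key C mC; have := key _ mC'.
by rewrite !ler_norml => /andP[? ?] /andP[? ?]; lra.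
Qed.

End disintegration_distance.

(** * The filter process *)

Section filter_process.
Context (R : realType) (X U Y : ptopologicalType).
Variables (T : stoch R (X * U)%type X) (Q : stoch R X Y).
Variables (F : stoch R (Pr R X * Y * U)%type X).
Variables (eta : stoch R (Pr R X * U)%type (Pr R X)).
Variables (b : nat -> set X).
Hypotheses (crX : completely_regular_space X) (bb : nat_base b).
Hypothesis Tcont : tv_continuous T.
Hypothesis Fdis : disintegrates T Q F.
Hypothesis etaE : filter_transition T Q F eta.

Let P (z : Pr R X) (u : U) : probability (borel Y) R := marginal T Q z u.

Lemma measurable_filter_eval z u (B : set (borel X)) : measurable B ->
  measurable_fun [set: borel Y] (fun y => F (z, y, u) B).
Proof.
move=> mB; apply: (measurableT_comp (measurable_kernel F _ mB)).
apply: (@continuous_borel Y (Pr R X * Y * U)%type (fun y => (z, y, u))) => y.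
have c1 : (fun y => (z, y)) @ y --> (z, y).
  apply: (@cvg_pair Y (Pr R X) Y (nbhs y) (nbhs z) (nbhs y)
    (nbhs_filter y) (nbhs_filter z) (nbhs_filter y) (cst z) id).
    exact: cvg_cst.
  exact: cvg_id.
apply: (@cvg_pair Y (Pr R X * Y)%type U (nbhs y) (nbhs (z, y)) (nbhs u)
  (nbhs_filter y) (nbhs_filter (z, y)) (nbhs_filter u) _ (cst u) c1).
exact: cvg_cst.
Qed.

Lemma measurable_filter z u : measurable_fun [set: borel Y]
  (fun y => kpr F (z, y, u) : borel (Pr R X)).
Proof.
apply: (measurable_fun_Pr bb) => B mB; exact: measurable_filter_eval.
Qed.

(** The filter transition is the image of the observation law under the
    posterior. *)
Lemma filter_transition_Rintegral z u (g : Pr R X -> R) :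
  continuous g -> (forall nu, 0 <= g nu <= 1) ->
  \int[kpr eta (z, u)]_(nu in [set: borel (Pr R X)]) g nu =
  \int[P z u]_(y in [set: borel Y]) g (kpr F (z, y, u)).
Proof.
move=> cg g01; rewrite /Rintegral; congr fine.
have mF := measurable_filter z u.
pose f y : borel (Pr R X) := kpr F (z, y, u).
rewrite (eq_measure_integral (pushforward (P z u) f)).
  rewrite ge0_integral_pushforward//.
  - by apply/measurable_EFinP; exact: continuous_borel_measurable.
  - by move=> nu _; rewrite lee_fin; case/andP: (g01 nu).
move=> D mD _.
pose FD : set (borel Y) := [set y | D (kpr F (z, y, u))].
have mFD : measurable FD by rewrite /FD -[X in measurable X]setTI; exact: mF.
transitivity (\int[P z u]_(y in [set: borel Y]) (\1_FD y)%:E)%E.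
  exact: etaE.
rewrite integral_indic; [|exact: measurableT|exact: mFD].
by rewrite setIT.
Qed.

Let posterior z u (B : set (borel X)) (y : Y) : R := fine (F (z, y, u) B).

Let posteriorE z u B y : measurable B -> F (z, y, u) B = (posterior z u B y)%:E.
Proof.
move=> mB; rewrite /posterior fineK//.
exact: (fin_num_measure (kpr F (z, y, u)) _ mB).
Qed.

Let posterior01 z u B y : measurable B -> 0 <= posterior z u B y <= 1.
Proof.
move=> mB; rewrite -!lee_fin -posteriorE// measure_ge0/=.
exact: (probability_le1 (kpr F (z, y, u)) mB).
Qed.

Let measurable_posterior z u B : measurable B ->
  measurable_fun [set: borel Y] (posterior z u B).
Proof.
by move=> mB; apply: measurableT_comp => //; exact: measurable_filter_eval.
Qed.

Let posteriorC z u B C : measurable B -> measurable C ->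
  \int[P z u]_(y in C) posterior z u B y = fine (joint T Q z u (B `*` C)).
Proof.
move=> mB mC; rewrite (Fdis _ _ mB mC) /Rintegral; congr fine.
by apply: eq_integral => y _; rewrite posteriorE.
Qed.

Section limit.
Variables (z_ : nat -> Pr R X) (z : Pr R X) (u_ : nat -> U) (u : U).
Hypotheses (zz : z_ @ \oo --> z) (uu : u_ @ \oo --> u).

Lemma marginal_tv_cvg (e : R) : 0 < e -> \forall n \near \oo,
  forall C, measurable C -> `|fine (P (z_ n) (u_ n) C) - fine (P z u C)| <= e.
Proof.
move=> e0; apply: filterS (joint_tv_continuous Q crX bb Tcont zz uu e0).
by move=> n H C mC; apply: H; exact: measurableX.
Qed.

Lemma filter_L1_cvg (B : set (borel X)) : measurable B ->
  \int[P z u]_y `|posterior (z_ n) (u_ n) B y - posterior z u B y|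
    @[n --> \oo] --> (0 : R).
Proof.
move=> mB; apply/cvgrPdist_le => e e0.
have e40 : 0 < e / 4 by rewrite divr_gt0.
have H := joint_tv_continuous Q crX bb Tcont zz uu e40.
apply: filterS H => n H.
rewrite sub0r normrN ger0_norm; last by apply: Rintegral_ge0.
have -> : e = 4 * (e / 4) by field.
apply: (@L1_dist_densities _ _ _ (P (z_ n) (u_ n)) (P z u)).
- exact: measurable_posterior.
- exact: measurable_posterior.
- by move=> y; exact: posterior01.
- by move=> y; exact: posterior01.
- by move=> C mC; apply: H; exact: measurableX.
- by move=> C mC; rewrite !posteriorC//; apply: H; exact: measurableX.
Qed.

(** Only countably many sets [B] are needed to detect weak convergence of the
    posteriors, so a single subsequence and a single null set suffice. *)
Lemma filter_subseq (D : set nat) : (forall N, exists2 n, (N <= n)%N & D n) ->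
  exists s : nat -> nat, [/\ s @ \oo --> \oo, forall j, D (s j) &
    {ae P z u, forall y,
      kpr F (z_ (s j), y, u_ (s j)) @[j --> \oo] --> kpr F (z, y, u)}].
Proof.
move=> DD.
(* The finite unions of basic sets are enumerated through the codes of the lists
   of indices; invalid codes stand for the empty union. *)
pose Bk (k : nat) : set (borel X) := base_union b (odflt [::] (unpickle k)).
have mBk k : measurable (Bk k) by exact: base_union_measurable.
have [s [sy Ds ae]] := ae_cvg_subseq (P := P z u)
  (h_ := fun n k => posterior (z_ n) (u_ n) (Bk k))
  (h := fun k => posterior z u (Bk k))
  (fun n k => measurable_posterior (z_ n) (u_ n) (mBk k))
  (fun k => measurable_posterior z u (mBk k))
  (fun n k y => posterior01 (z_ n) (u_ n) y (mBk k))
  (fun k y => posterior01 z u y (mBk k))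
  (fun k => filter_L1_cvg (mBk k)) DD.
exists s; split => //; apply: filterS ae => y cy.
apply: (cvg_base_union bb) => l e e0.
have := cy (pickle l); rewrite /Bk pickleK/= => /cvgrPdist_lt /(_ e e0).
apply: filterS => j; rewrite ltr_norml => /andP[_].
by rewrite ltrBlDr addrC -ltrBlDr.
Qed.

Lemma filter_transition_cvg :
  kpr eta (z_ k, u_ k) @[k --> \oo] --> kpr eta (z, u).
Proof.
apply: Pr_filter_cvg => g cg g01 e e0.
rewrite filter_transition_Rintegral//.
have mg := continuous_borel_measurable cg.
pose a n := \int[P (z_ n) (u_ n)]_(y in [set: borel Y])
  g (kpr F (z_ n, y, u_ n)).
pose a0 := \int[P z u]_(y in [set: borel Y]) g (kpr F (z, y, u)).
suff : \forall n \near \oo, a0 - e < a n.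
  by apply: filterS => n /=; rewrite filter_transition_Rintegral.
apply: contrapT => notnear.
have DD N : exists2 n, (N <= n)%N & a n <= a0 - e.
  apply: contrapT => no; apply: notnear; exists N => // n /= Nn.
  by rewrite ltNge; apply/negP => an; apply: no; exists n.
(* Among the indices violating the bound, there is a subsequence along which
   the posteriors, hence also the integrals, converge to their limits. *)
have [s [sy Ds ae]] := filter_subseq DD.
pose gF n y := g (kpr F (z_ n, y, u_ n)).
have mgF n : measurable_fun [set: borel Y] (gF n).
  exact: (measurableT_comp mg (measurable_filter (z_ n) (u_ n))).
have mgF0 : measurable_fun [set: borel Y] (fun y => g (kpr F (z, y, u))).
  exact: (measurableT_comp mg (measurable_filter z u)).
have c0 : \int[P z u]_(y in [set: borel Y]) gF (s j) y @[j --> \oo] --> a0.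
  apply: (@Rintegral_bounded_cvg _ _ _ _ _ _ 1) => //.
    by move=> j y; have /andP[? ?] := g01 (kpr F (z_ (s j), y, u_ (s j)));
       rewrite ger0_norm.
  apply: (@filterS _ _ (ae_filter_ringOfSetsType (P z u)) _ _ _ ae) => y cy.
  by apply: cvg_comp cy _; exact: cg.
have e20 : 0 < e / 2 by rewrite divr_gt0.
have n1 : \forall j \near \oo, forall C, measurable C ->
    `|fine (P (z_ (s j)) (u_ (s j)) C) - fine (P z u C)| <= e / 2.
  exact: sy _ (marginal_tv_cvg e20).
move/cvgrPdist_lt : c0 => /(_ _ e20) n2.
have [j [/= j1 j2]] := filter_ex (filterI n1 n2).
have := dist_Rintegral_le (mgF (s j)) (fun y => g01 _) j1.
rewrite -/(a (s j)) ler_norml => /andP[+ _].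
move: j2; rewrite ltr_norml => /andP[_].
have := Ds j => /=.
move: (Rintegral _ _ _) (a (s j)) => p q; lra.
Qed.

End limit.
End filter_process.

Theorem theorem2 (R : realType) (n p m : nat)
  (XX : set 'rV[R]_n) (UU : set 'rV[R]_p) (YY : set 'rV[R]_m)
  (X0 : XX !=set0) (U0 : UU !=set0) (Y0 : YY !=set0)
  (mX : measurable (XX : set (borel 'rV[R]_n)))
  (mU : measurable (UU : set (borel 'rV[R]_p)))
  (mY : measurable (YY : set (borel 'rV[R]_m)))
  (X : ptopologicalType := subsp X0) (U : ptopologicalType := subsp U0)
  (Y : ptopologicalType := subsp Y0) (Z : ptopologicalType := Pr R X)
  (T : stoch R (X * U)%type X) (Q : stoch R X Y)
  (F : stoch R (Z * Y * U)%type X) (eta : stoch R (Z * U)%type Z) :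
  tv_continuous T ->
  disintegrates T Q F ->
  filter_transition T Q F eta ->
  forall (z_ : nat -> Z) (z : Z) (u_ : nat -> U) (u : U),
    z_ k @[k --> \oo] --> z -> u_ k @[k --> \oo] --> u ->
    kpr eta (z_ k, u_ k) @[k --> \oo] --> kpr eta (z, u).
Proof.
move=> Tcont Fdis etaE z_ z u_ u zz uu.
have [b bb] := subsp_nat_base X0.
have crX := @subsp_completely_regular _ _ _ X0.
exact: (filter_transition_cvg crX bb Tcont Fdis etaE zz uu).
Qed.
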